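(* Let $n\ge 2$ be an integer. Every $n\times n$ matrix constructed by Algorithm NCON1 (described in the context) is an N-matrix of the first category. Conversely, every $n\times n$ N-matrix of the first category can be constructed as a permutational similarity of a matrix constructed by Algorithm NCON1; i.e., if $A\in\mathbb{R}^{n\times n}$ is an N-matrix of the first category, then there are a permutation matrix $P$ and a matrix $B$ constructed by Algorithm NCON1 such that $A=P^TBP$.
   Context: A real $n\times n$ matrix $A=[a_{ij}]$ is an N-matrix if all of its principal minors (determinants of submatrices with rows and columns indexed by the same nonempty subset of $\{1,\dots,n\}$) are negative; it is a P-matrix if all of its principal minors are positive. An N-matrix is of the first category if $a_{ij}>0$ for some $i,j$, and of the second category if $a_{ij}<0$ for all $i,j$. Inequalities for vectors and matrices are entrywise. For $x\in\mathbb{R}^i$ and $\alpha\subseteq\{1,\dots,i\}$, $x[\alpha]$ is the subvector of $x$ of entries indexed by $\alpha$; conditions on an empty subvector are vacuous. Algorithm NCON2 (nondeterministic; constructs a $k\times k$ matrix, $k\ge1$): 1. Choose a $1\times1$ real matrix $A_1<0$. 2. For $i=1,\dots,k-1$, given the $i\times i$ matrix $A_i$: (a) choose $a_i<0$ and $x^{(i)},y^{(i)}\in\mathbb{R}^i$ with $x^{(i)}<0$, $y^{(i)}<0$ such that $A_i-\frac{1}{a_i}x^{(i)}{y^{(i)}}^T$ is a P-matrix; (b) form $A_{i+1}=\begin{bmatrix}A_i & x^{(i)}\\ {y^{(i)}}^T & a_i\end{bmatrix}$. 3. Output $A_k$. Algorithm NCON1 (nondeterministic; constructs an $n\times n$ matrix,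 $n\ge2$), with a chosen integer $k$, $1\le k<n$: 1. Construct a $k\times k$ matrix $A_k$ using Algorithm NCON2. 2. For $i=k,\dots,n-1$, given the $i\times i$ matrix $A_i$: (a) choose $a_i\in\mathbb{R}$ with $a_i<0$ and $x^{(i)},y^{(i)}\in\mathbb{R}^i$ such that $x^{(i)}[\{1,\dots,k\}]>0$, $y^{(i)}[\{1,\dots,k\}]>0$, $x^{(i)}[\{k+1,\dots,i\}]<0$, $y^{(i)}[\{k+1,\dots,i\}]<0$, and $A_i-\frac{1}{a_i}x^{(i)}{y^{(i)}}^T$ is a P-matrix; (b) form the $(i+1)\times(i+1)$ matrix $A_{i+1}=\begin{bmatrix}A_i & x^{(i)}\\ {y^{(i)}}^T & a_i\end{bmatrix}$. 3. Output $A=A_n$. A matrix is ''constructed by'' one of these algorithms if it equals the output for some choices (including of $k$ in NCON1) satisfying the stated requirements. *)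

(* Defs.v *)
From HB Require Import structures.
From mathcomp Require Import all_boot all_order all_algebra.

Set Implicit Arguments.
Unset Strict Implicit.
Unset Printing Implicit Defensive.

Import Order.TTheory GRing.Theory Num.Theory.
Local Open Scope ring_scope.

Definition principal_minor (R : realFieldType) (n : nat) (A : 'M[R]_n)
    (alpha : {set 'I_n}) : R :=
  \det (mxsub (fun i : 'I_#|alpha| => enum_val i)
              (fun j : 'I_#|alpha| => enum_val j) A).

Definition Nmatrix (R : realFieldType) (n : nat) (A : 'M[R]_n) : Prop :=
  forall alpha : {set 'I_n}, alpha != set0 -> principal_minor A alpha < 0.

Definition Pmatrix (R : realFieldType) (n : nat) (A : 'M[R]_n) : Prop :=
  forall alpha : {set 'I_n}, alpha != set0 -> 0 < principal_minor A alpha.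

Definition Nmatrix_first_category (R : realFieldType) (n : nat)
    (A : 'M[R]_n) : Prop :=
  Nmatrix A /\ exists i j, 0 < A i j.

Definition bordered_mx (R : realFieldType) (i : nat) (A : 'M[R]_i)
    (x y : 'cV[R]_i) (a : R) : 'M[R]_(i + 1) :=
  block_mx A x y^T a%:M.

(* A nondeterministic run of an algorithm is a derivation: one constructor
   for the initial choice, one for each pass through the loop. *)

Inductive NCON2 (R : realFieldType) : forall k : nat, 'M[R]_k -> Prop :=
| NCON2_init (A : 'M[R]_1) :
    A 0 0 < 0 -> NCON2 A
| NCON2_step (i : nat) (A : 'M[R]_i) (a : R) (x y : 'cV[R]_i) :
    NCON2 A ->
    a < 0 ->
    (forall j, x j 0 < 0) ->
    (forall j, y j 0 < 0) ->
    Pmatrix (A - a^-1 *: (x *m y^T)) ->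
    NCON2 (bordered_mx A x y a).

(* Indices are 0-based: {1, ..., k} is j < k and {k+1, ..., i} is k <= j. *)
Inductive NCON1_run (R : realFieldType) (k : nat) :
    forall n : nat, 'M[R]_n -> Prop :=
| NCON1_init (A : 'M[R]_k) :
    NCON2 A -> NCON1_run k A
| NCON1_step (i : nat) (A : 'M[R]_i) (a : R) (x y : 'cV[R]_i) :
    NCON1_run k A ->
    a < 0 ->
    (forall j : 'I_i, (j < k)%N -> 0 < x j 0) ->
    (forall j : 'I_i, (j < k)%N -> 0 < y j 0) ->
    (forall j : 'I_i, (k <= j)%N -> x j 0 < 0) ->
    (forall j : 'I_i, (k <= j)%N -> y j 0 < 0) ->
    Pmatrix (A - a^-1 *: (x *m y^T)) ->
    NCON1_run k (bordered_mx A x y a).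

Definition NCON1 (R : realFieldType) (n : nat) (A : 'M[R]_n) : Prop :=
  exists k : nat, (1 <= k < n)%N /\ NCON1_run k A.

(* Main.v *)
Require Import Defs.
From HB Require Import structures.
From mathcomp Require Import all_boot all_order all_algebra.
From mathcomp Require Import perm ring lra.

Set Implicit Arguments.
Unset Strict Implicit.
Unset Printing Implicit Defensive.

Import Order.TTheory GRing.Theory Num.Theory.
Local Open Scope ring_scope.

(** Both directions rest on one equivalence, [Nmatrix_bordered]: for [a < 0],
    bordering [A] by [x], [y] and [a] gives an N-matrix exactly when [A] is an
    N-matrix and the Schur complement [A - a^-1 *: (x *m y^T)] is a P-matrix.
    A principal minor of the bordered matrix avoiding the last index is a
    principal minor of [A]; one containing it is [a] times a principal minor of
    the Schur complement (or [a] itself).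

    Hence every step of either algorithm preserves being an N-matrix, and the
    first step with mixed signs puts a positive entry in the last column.

    Conversely, an N-matrix can be dismantled by removing its last row and
    column again and again, and each Schur complement met is automatically a
    P-matrix; only the signs of the borders have to be arranged. The minors of
    order 1, 2 and 3 force [A i j * A j k * A k i < 0] for all [i], [j], [k]
    ([Nmatrix_triangle_lt0]). Since the sign pattern is symmetric, the relation
    [A i j < 0] is therefore an equivalence with at most two classes
    ([Nmatrix_sign_classes]), and exactly two when some entry is positive.
    Listing one class before the other ([perm_ord_front]) produces the block
    sign pattern that the algorithm builds, with [k] the size of the class
    listed first. *)

(** * Principal minors along injective index maps *)

(** Two injective enumerations of the same index set differ by a permutation
    [s], which acts on rows and on columns and so contributes its sign twice.
    This frees principal minors from the particular enumeration [enum_val]. *)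
Lemma det_mxsub_codom (R : comPzRingType) (n m p : nat) (A : 'M[R]_n)
    (f : 'I_m -> 'I_n) (g : 'I_p -> 'I_n) :
  injective f -> injective g -> codom f =i codom g ->
  \det (mxsub f f A) = \det (mxsub g g A).
Proof.
move=> f_inj g_inj fg.
have perm_fg : perm_eq (codom f) (codom g).
  by apply: uniq_perm => //; rewrite codomE map_inj_uniq ?enum_uniq.
have mp : m = p by have := perm_size perm_fg; rewrite !size_codom !card_ord.
case: p / mp in g g_inj fg perm_fg *.
have {perm_fg} : perm_eq (codom f) [tuple g i | i < m].
  by rewrite (_ : tval _ = codom g) // codomE -[enum _]val_ord_tuple.
case/tuple_permP=> s; rewrite codomE => /eq_in_map fE.
have {}fE i : f i = g (s i) by rewrite fE ?mem_enum // tnth_mktuple.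
have -> : mxsub f f A = perm_mx s *m mxsub g g A *m (perm_mx s)^T.
  rewrite tr_perm_mx -row_permE -col_permE.
  by apply/matrixP=> i j; rewrite !mxE !fE.
by rewrite !det_mulmx det_tr det_perm mulrC mulrA -expr2 sqrr_sign mul1r.
Qed.

Lemma principal_minor_inj (R : realFieldType) (n m : nat) (A : 'M[R]_n)
    (f : 'I_m -> 'I_n) (alpha : {set 'I_n}) :
  injective f -> codom f =i alpha ->
  principal_minor A alpha = \det (mxsub f f A).
Proof.
move=> f_inj f_alpha; apply: det_mxsub_codom => //; first exact: enum_val_inj.
move=> i; rewrite f_alpha; apply/codomP/idP => [[j ->]|i_alpha].
  exact: enum_valP.
by exists (enum_rank_in i_alpha i); rewrite enum_rankK_in.
Qed.

Lemma Nmatrix_det_inj (R : realFieldType) (n m : nat) (A : 'M[R]_n)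
    (f : 'I_m.+1 -> 'I_n) :
  Nmatrix A -> injective f -> \det (mxsub f f A) < 0.
Proof.
move=> NA f_inj; pose alpha := [set i in codom f].
rewrite -(principal_minor_inj A (alpha := alpha)) //.
  by apply: NA; apply/set0Pn; exists (f ord0); rewrite inE codom_f.
by move=> i; rewrite inE.
Qed.

Lemma Nmatrix_mxsub (R : realFieldType) (n m : nat) (A : 'M[R]_n)
    (f : 'I_m -> 'I_n) :
  injective f -> Nmatrix A -> Nmatrix (mxsub f f A).
Proof.
move=> f_inj NA alpha; rewrite -card_gt0 /principal_minor.
case: #|alpha| (@enum_val _ (mem alpha)) (@enum_val_inj _ (mem alpha)) => //.
move=> p g g_inj _; rewrite -mxsub_comp.
exact/Nmatrix_det_inj/(inj_comp f_inj).
Qed.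

(** * Bordered matrices and Schur complements *)

(** Eliminating [x] with the pivot [a] leaves the Schur complement. *)
Lemma det_bordered (R : realFieldType) (i : nat) (A : 'M[R]_i) (x y : 'cV_i)
    (a : R) :
  a != 0 -> \det (bordered_mx A x y a) = a * \det (A - a^-1 *: (x *m y^T)).
Proof.
move=> a_neq0.
have -> : bordered_mx A x y a =
    block_mx 1%:M (a^-1 *: x) 0 1%:M *m
    block_mx (A - a^-1 *: (x *m y^T)) 0 y^T a%:M.
  rewrite mulmx_block !mul1mx !mul0mx !add0r -scalemxAl subrK.
  by rewrite mul_mx_scalar scalerA divff // scale1r.
rewrite det_mulmx (det_ublock 1%:M) (det_lblock _ y^T) !det1 !mul1r mulrC.
by rewrite det_scalar1.
Qed.

(** The index map selecting, inside a bordered matrix, the border of the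
    submatrix selected by [f]; [mxsub_bordered] is its purpose. *)
Definition border_idx (m i : nat) (f : 'I_m -> 'I_i) (j : 'I_(m + 1)) :
    'I_(i + 1) :=
  match split j with inl j' => lshift 1 (f j') | inr k => rshift i k end.

Lemma border_idx_inj (m i : nat) (f : 'I_m -> 'I_i) :
  injective f -> injective (border_idx f).
Proof.
move=> f_inj j l; rewrite /border_idx.
case: (split_ordP j) => j' ->; case: (split_ordP l) => l' -> /eqP.
- by rewrite eq_lshift => /eqP/f_inj ->.
- by rewrite eq_lrshift.
- by rewrite eq_rlshift.
- by rewrite eq_rshift => /eqP ->.
Qed.

Lemma mxsub_bordered (R : realFieldType) (m i : nat) (f : 'I_m -> 'I_i)
    (A : 'M[R]_i) (x y : 'cV_i) (a : R) :
  mxsub (border_idx f) (border_idx f) (bordered_mx A x y a) =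
  bordered_mx (mxsub f f A) (rowsub f x) (rowsub f y) a.
Proof.
apply/matrixP=> j l; rewrite mxE /border_idx /bordered_mx.
case: (split_ordP j) => j' ->; case: (split_ordP l) => l' ->.
- by rewrite !block_mxEul mxE.
- by rewrite !block_mxEur mxE.
- by rewrite !block_mxEdl !mxE.
- by rewrite !block_mxEdr.
Qed.

Lemma mxsub_bordered_lshift (R : realFieldType) (m i : nat)
    (f : 'I_m -> 'I_i) (A : 'M[R]_i) (x y : 'cV_i) (a : R) :
  mxsub (lshift 1 \o f) (lshift 1 \o f) (bordered_mx A x y a) = mxsub f f A.
Proof. by apply/matrixP=> j l; rewrite mxE [RHS]mxE; exact: block_mxEul. Qed.

Lemma det_mxsub_bordered (R : realFieldType) (m i : nat) (f : 'I_m -> 'I_i)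
    (A : 'M[R]_i) (x y : 'cV_i) (a : R) :
  a != 0 ->
  \det (mxsub (border_idx f) (border_idx f) (bordered_mx A x y a)) =
  a * \det (mxsub f f (A - a^-1 *: (x *m y^T))).
Proof.
move=> a_neq0; rewrite mxsub_bordered det_bordered //; congr (_ * \det _).
apply/matrixP=> j l; rewrite !mxE; congr (_ - _ * _).
by apply: eq_bigr => k _; rewrite !mxE.
Qed.

(** The principal minors of the bordered matrix split into those of [A] and
    [a] times those of the Schur complement, and [a] is negative. *)
Lemma Nmatrix_bordered (R : realFieldType) (i : nat) (A : 'M[R]_i)
    (x y : 'cV_i) (a : R) :
  a < 0 ->
  Nmatrix (bordered_mx A x y a) <->
  Nmatrix A /\ Pmatrix (A - a^-1 *: (x *m y^T)).
Proof.
move=> a_lt0; have a_neq0 : a != 0 by rewrite lt_eqF.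
split=> [NB|[NA PS] alpha alpha_neq0].
  split.
    rewrite -[A]mxsub_id -(mxsub_bordered_lshift id A x y a).
    exact/Nmatrix_mxsub/NB/lshift_inj.
  move=> alpha _; rewrite -(nmulr_rlt0 _ a_lt0).
  rewrite /principal_minor -det_mxsub_bordered //.
  move: (border_idx_inj (@enum_val_inj _ (mem alpha))).
  by move: (border_idx _); rewrite addn1 => f; exact: Nmatrix_det_inj.
pose beta := [set j | lshift 1 j \in alpha].
have mem_alpha_l j : (lshift 1 j \in alpha) = (j \in beta) by rewrite inE.
have [last_in|last_out] := boolP (rshift i 0 \in alpha).
  have fE : codom (border_idx (@enum_val _ (mem beta))) =i alpha.
    move=> j; case: (split_ordP j) => [j' ->|k ->].
      rewrite mem_alpha_l; apply/codomP/idP => [[l]|j'_in].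
        rewrite /border_idx; case: (split_ordP l) => l' _ /eqP.
          by rewrite eq_lshift => /eqP ->; exact: enum_valP.
        by rewrite eq_lrshift.
      exists (lshift 1 (enum_rank_in j'_in j')).
      by rewrite /border_idx (unsplitK (inl _)) enum_rankK_in.
    rewrite (ord1 k) last_in; apply/codomP.
    by exists (rshift _ 0); rewrite /border_idx (unsplitK (inr _)).
  rewrite (principal_minor_inj _ _ fE); last first.
    exact/border_idx_inj/enum_val_inj.
  rewrite det_mxsub_bordered // nmulr_rlt0 //.
  (* For empty [beta] the minor is [a] alone, as its cofactor is 0 x 0. *)
  have [beta0|] := eqVneq beta set0; last exact: PS.
  have : #|beta| = 0%N by rewrite beta0 cards0.
  move: (@enum_val _ (mem beta)) => f c0.
  by move: f; rewrite c0 => f; rewrite det_mx00.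
have fE : codom (lshift 1 \o @enum_val _ (mem beta)) =i alpha.
  move=> j; case: (split_ordP j) => [j' ->|k ->].
    rewrite mem_alpha_l; apply/codomP/idP => [[l /= /lshift_inj ->]|j'_in].
      exact: enum_valP.
    by exists (enum_rank_in j'_in j'); rewrite /= enum_rankK_in.
  rewrite (ord1 k) (negbTE last_out); apply/codomP => -[l /= /eqP].
  by rewrite eq_rlshift.
rewrite (principal_minor_inj _ _ fE); last first.
  exact: inj_comp (@lshift_inj _ _) enum_val_inj.
rewrite mxsub_bordered_lshift; apply: (NA beta); have /set0Pn[j] := alpha_neq0.
case: (split_ordP j) => [j' ->|k ->]; last first.
  by rewrite (ord1 k) (negbTE last_out).
by rewrite mem_alpha_l => j'_in; apply/set0Pn; exists j'.
Qed.

(** * The algorithms produce N-matrices *)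

Lemma NCON2_Nmatrix (R : realFieldType) (k : nat) (A : 'M[R]_k) :
  NCON2 A -> Nmatrix A.
Proof.
elim=> [{}A A_lt0|i {}A a x y _ NA a_lt0 _ _ PS]; last exact/Nmatrix_bordered.
move=> alpha /set0Pn[j j_in].
have fE : codom (@id 'I_1) =i alpha.
  by move=> l; rewrite (ord1 l) -(ord1 j) j_in codom_f.
by rewrite (principal_minor_inj _ _ fE) // det_mx11 mxE.
Qed.

Lemma NCON1_run_Nmatrix (R : realFieldType) (k n : nat) (A : 'M[R]_n) :
  NCON1_run k A -> Nmatrix A.
Proof.
elim=> [{}A|i {}A a x y _ NA a_lt0 _ _ _ _ PS]; first exact: NCON2_Nmatrix.
exact/Nmatrix_bordered.
Qed.

Lemma NCON1_run_leq (R : realFieldType) (k n : nat) (A : 'M[R]_n) :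
  NCON1_run k A -> (k <= n)%N.
Proof.
by elim=> // i B a x y _ le_ki *; exact: leq_trans le_ki (leq_addr _ _).
Qed.

(** Since [k < n], the run ends with a mixed-sign step, whose border [x] is
    positive at the index 0. *)
Lemma NCON1_first_category (R : realFieldType) (n : nat) (A : 'M[R]_n) :
  NCON1 A -> Nmatrix_first_category A.
Proof.
case=> k [/andP[k_gt0 lt_kn] run]; split; first exact: NCON1_run_Nmatrix run.
case: n A / run lt_kn => [A _|i A a x y run _ x_gt0 _ _ _ _ _].
  by rewrite ltnn.
pose j := Ordinal (leq_trans k_gt0 (NCON1_run_leq run)).
by exists (lshift 1 j), (rshift i 0); rewrite block_mxEur; exact: x_gt0.
Qed.

(** * The sign pattern of an N-matrix *)

Lemma Nmatrix_diag_lt0 (R : realFieldType) (n : nat) (A : 'M[R]_n) i :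
  Nmatrix A -> A i i < 0.
Proof.
move=> NA; have f_inj : injective (fun _ : 'I_1 => i).
  by move=> j l _; rewrite !ord1.
by have := Nmatrix_det_inj NA f_inj; rewrite det_mx11 mxE.
Qed.

Lemma Nmatrix_minor2 (R : realFieldType) (n : nat) (A : 'M[R]_n) i j :
  Nmatrix A -> i != j -> A i i * A j j < A i j * A j i.
Proof.
move=> NA neq_ij; have f_inj : injective (tnth [tuple i; j]).
  by apply/tuple_uniqP; rewrite /= inE neq_ij.
have := Nmatrix_det_inj NA f_inj.
rewrite (expand_det_row _ ord0) !big_ord_recl big_ord0 /cofactor.
rewrite !det_mx11 !mxE /= !(tnth_nth i) /=.
lra.
Qed.

Lemma Nmatrix_minor3 (R : realFieldType) (n : nat) (A : 'M[R]_n) i j k :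
  Nmatrix A -> uniq [:: i; j; k] ->
  A i i * A j j * A k k + A i j * A j k * A k i + A i k * A k j * A j i <
  A i i * (A j k * A k j) + A j j * (A i k * A k i) + A k k * (A i j * A j i).
Proof.
move=> NA ijk; have f_inj : injective (tnth [tuple i; j; k]).
  exact/tuple_uniqP.
have := Nmatrix_det_inj NA f_inj.
rewrite (expand_det_row _ ord0) !big_ord_recl big_ord0 /cofactor.
rewrite !(expand_det_row _ (@ord0 1)) !big_ord_recl !big_ord0 /cofactor.
rewrite !det_mx11 !mxE /= !(tnth_nth i) /=.
lra.
Qed.

(** [A i j * A j i] exceeds [A i i * A j j], a product of two negatives. *)
Lemma Nmatrix_sym_gt0 (R : realFieldType) (n : nat) (A : 'M[R]_n) i j :
  Nmatrix A -> 0 < A i j * A j i.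
Proof.
move=> NA; have [->|neq_ij] := eqVneq i j.
  by rewrite nmulr_rgt0 Nmatrix_diag_lt0.
apply: lt_trans (Nmatrix_minor2 NA neq_ij).
by rewrite nmulr_rgt0 Nmatrix_diag_lt0.
Qed.

Lemma Nmatrix_neq0 (R : realFieldType) (n : nat) (A : 'M[R]_n) i j :
  Nmatrix A -> A i j != 0.
Proof.
by move=> /(Nmatrix_sym_gt0 i j); apply: contraTneq => ->; rewrite mul0r ltxx.
Qed.

(** Suppose the cyclic product over three distinct indices were nonnegative.
    The reverse cyclic product has the same sign, since entries in symmetric
    positions do, so both cyclic terms of the minor of order 3 are nonnegative.
    With [d] the product of the three diagonal entries, each of the remaining
    terms [- A i i * (A j k * A k j)] is larger than [- d] by the minors of
    order 2. The minor would then exceed [d - 3 * d = - 2 * d], which is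
    positive. With repeated indices the product is a diagonal entry times a
    positive symmetric product. *)
Lemma Nmatrix_triangle_lt0 (R : realFieldType) (n : nat) (A : 'M[R]_n) i j k :
  Nmatrix A -> A i j * A j k * A k i < 0.
Proof.
move=> NA; have diag l := Nmatrix_diag_lt0 l NA.
have sym l m := Nmatrix_sym_gt0 l m NA.
have [->|ij] := eqVneq i j; first by rewrite -mulrA nmulr_rlt0.
have [->|jk] := eqVneq j k; first by rewrite mulrAC pmulr_rlt0.
have [->|ik] := eqVneq i k; first by rewrite pmulr_rlt0.
rewrite ltNge; apply/negP => t_ge0.
(* The two cyclic products multiply to a product of symmetric pairs. *)
have u_ge0 : 0 <= A i k * A k j * A j i.
  rewrite leNgt; apply/negP => u_lt0.
  have : 0 < A i j * A j i * (A j k * A k j) * (A k i * A i k).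
    by do 2?[apply: mulr_gt0 => //].
  have -> : A i j * A j i * (A j k * A k j) * (A k i * A i k) =
    (A i j * A j k * A k i) * (A i k * A k j * A j i) by ring.
  by rewrite ltNge mulr_ge0_le0 // ltW.
have := Nmatrix_minor3 NA (i := i) (j := j) (k := k).
rewrite /= !inE negb_or ij ik jk => /(_ isT).
have : A i i * (A j k * A k j) < A i i * (A j j * A k k).
  by rewrite ltr_nM2l // Nmatrix_minor2.
have : A j j * (A i k * A k i) < A j j * (A i i * A k k).
  by rewrite ltr_nM2l // Nmatrix_minor2.
have : A k k * (A i j * A j i) < A k k * (A i i * A j j).
  by rewrite ltr_nM2l // Nmatrix_minor2.
have : A i i * A j j * A k k < 0 by rewrite nmulr_llt0 ?nmulr_rgt0.
lra.
Qed.

(** As no entry vanishes, a negative product around [i], [j], [l] says that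
    [A j l] is negative exactly when [A i j] and [A l i] have the same sign. *)
Lemma Nmatrix_sign_classes (R : realFieldType) (n : nat) (A : 'M[R]_n) i j l :
  Nmatrix A -> (A j l < 0) = ((A i j < 0) == (A i l < 0)).
Proof.
move=> NA; have := Nmatrix_triangle_lt0 i j l NA.
have := Nmatrix_sym_gt0 i l NA.
case: (ltgtP (A i l) 0) (Nmatrix_neq0 i l NA) => // il _.
  rewrite nmulr_rgt0 // => li; rewrite nmulr_llt0 //.
  case: (ltgtP (A i j) 0) (Nmatrix_neq0 i j NA) => // ij _.
    by rewrite nmulr_rgt0 // eqxx.
  by rewrite pmulr_rgt0 // => /ltW; rewrite leNgt => /negbTE.
rewrite pmulr_rgt0 // => li; rewrite pmulr_llt0 //.
case: (ltgtP (A i j) 0) (Nmatrix_neq0 i j NA) => // ij _.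
  by rewrite nmulr_rlt0 // => /ltW; rewrite leNgt => /negbTE.
by rewrite pmulr_rlt0.
Qed.

(** * Dismantling an N-matrix *)

Lemma bordered_mxK (R : realFieldType) (n : nat) (A : 'M[R]_(n + 1)) :
  A = bordered_mx (ulsubmx A) (ursubmx A) (dlsubmx A)^T
        (A (rshift n 0) (rshift n 0)).
Proof.
rewrite -{1}[A]submxK /bordered_mx trmxK; congr block_mx.
by rewrite [LHS]mx11_scalar !mxE.
Qed.

Lemma Nmatrix_lt0_NCON2 (R : realFieldType) (n : nat) (A : 'M[R]_n) :
  (0 < n)%N -> Nmatrix A -> (forall i j, A i j < 0) -> NCON2 A.
Proof.
elim: n A => // -[|n] IH A _ NA A_lt0; first exact: NCON2_init.
(* Steps of the algorithm live in size [i + 1], not [i.+1]. *)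
move: A NA A_lt0; rewrite -(addn1 n.+1) => A NA A_lt0.
have a_lt0 := A_lt0 (rshift _ 0) (rshift _ 0).
rewrite (bordered_mxK A) in NA *.
have [NA' PS] := (Nmatrix_bordered _ _ _ a_lt0).1 NA.
apply: NCON2_step => //; first by apply: IH => // i j; rewrite !mxE.
all: by move=> j; rewrite !mxE.
Qed.

(** The block sign pattern is inherited by leading submatrices, so the last
    row and column can be removed down to size [k], where all entries are
    negative. *)
Lemma Nmatrix_NCON1_run (R : realFieldType) (k n : nat) (A : 'M[R]_n) :
  (0 < k <= n)%N -> Nmatrix A ->
  (forall i j, (A i j < 0) = ((i < k)%N == (j < k)%N)) -> NCON1_run k A.
Proof.
case/andP=> k_gt0; elim: n A => [|n IH] A; first by case: k k_gt0.
rewrite leq_eqVlt => /predU1P[k_n|lt_kn] NA signA.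
  case: n.+1 / k_n A NA signA {IH} => A NA signA.
  by apply/NCON1_init/Nmatrix_lt0_NCON2 => // i j; rewrite signA !ltn_ord.
move: A NA signA; rewrite -(addn1 n) => A NA signA.
have nk (j : 'I_1) : (rshift n j < k)%N = false.
  by rewrite (ord1 j) /= addn0; apply/negbTE; rewrite -leqNgt.
have a_lt0 : A (rshift _ 0) (rshift _ 0) < 0 by rewrite signA eqxx.
have gt0A (i j : 'I_(n + 1)) : ((i < k) != (j < k))%N -> 0 < A i j.
  by move=> /negbTE sij; rewrite lt_def Nmatrix_neq0 //= leNgt signA sij.
rewrite (bordered_mxK A); rewrite [X in Nmatrix X](bordered_mxK A) in NA.
have [NA' PS] := (Nmatrix_bordered _ _ _ a_lt0).1 NA.
apply: NCON1_step => //.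
- by apply: IH => // i j; rewrite !mxE signA.
- by move=> j jk; rewrite !mxE gt0A // nk /= jk.
- by move=> j jk; rewrite !mxE gt0A // nk /= jk.
- by move=> j jk; rewrite !mxE signA nk /= ltnNge jk.
- by move=> j jk; rewrite !mxE signA nk /= ltnNge jk.
Qed.

Lemma perm_ord_front (n : nat) (c : pred 'I_n) :
  exists s : {perm 'I_n}, forall i : 'I_n, c (s i) = (i < #|c|)%N.
Proof.
pose e := enum c ++ enum (predC c).
have perm_e : perm_eq e (ord_tuple n).
  apply: uniq_perm.
  - rewrite cat_uniq !enum_uniq andbT; apply/hasPn => i.
    by rewrite !mem_enum.
  - by rewrite val_ord_tuple enum_uniq.
  - by move=> i; rewrite mem_cat [RHS]mem_enum !mem_enum; exact: orbN.
have [s eE] := tuple_permP perm_e; exists s => i.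
have -> : s i = nth i e i.
  by rewrite eE -tnth_nth tnth_mktuple tnth_ord_tuple.
have : (i < size e)%N by rewrite eE size_tuple.
rewrite nth_cat size_cat cardE.
case: (ltnP i (size (enum c))) => [lt_ic _|le_ci lt_ie].
  by have := mem_nth i lt_ic; rewrite mem_enum.
rewrite -ltn_subLR // in lt_ie.
by have := mem_nth i lt_ie; rewrite mem_enum => /negbTE.
Qed.

Theorem theorem4p3 (R : realFieldType) (n : nat) (hn : (2 <= n)%N) :
  (forall A : 'M[R]_n, NCON1 A -> Nmatrix_first_category A) /\
  (forall A : 'M[R]_n, Nmatrix_first_category A ->
     exists P B : 'M[R]_n,
       [/\ is_perm_mx P, NCON1 B & A = P^T *m B *m P]).
Proof.
split=> [A|A [NA [i0 [j0 A_gt0]]]]; first exact: NCON1_first_category.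
(* [c] is the sign class containing [i0]; the positive entry puts [j0] in the
   other class, so [c] is proper. *)
pose c j := A i0 j < 0; have [s sE] := perm_ord_front c.
exists (perm_mx s), (mxsub s s A); split.
- by apply/is_perm_mxP; exists s.
- exists #|c|; have c_lt_n : (0 < #|c| < n)%N.
    apply/andP; split.
      by apply/card_gt0P; exists i0; apply: Nmatrix_diag_lt0.
    rewrite -[ltnRHS]card_ord -(cardC c) -[ltnLHS]addn0 ltn_add2l.
    by apply/card_gt0P; exists j0; rewrite inE -leNgt ltW.
  have /andP[c_gt0 c_ltn] := c_lt_n; split=> //.
  apply: Nmatrix_NCON1_run; first by rewrite c_gt0 ltnW.
    exact/Nmatrix_mxsub/NA/perm_inj.
  by move=> i j; rewrite mxE (Nmatrix_sign_classes i0) // -!sE.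
- rewrite tr_perm_mx -row_permE -[X in _ *m perm_mx X]invgK -col_permE.
  by apply/matrixP => i j; rewrite !mxE !permKV.
Qed.
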